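(* Let $k$ be a field, let $G$ be a finite simple graph on $n$ vertices $x_1,\ldots,x_n$, let $R = k[x_1,\ldots,x_n]$, and let $I(G) \subseteq R$ be the edge ideal of $G$. Then \[ \operatorname{reg}(R/I(G)) + \deg h_{R/I(G)}(t) \leq n. \]
   Context: For a finite simple graph $G$ with vertex set $V(G) = \{x_1,\ldots,x_n\}$ and edge set $E(G)$, the edge ideal of $G$ is the ideal $I(G) = (x_ix_j \mid \{x_i,x_j\} \in E(G))$ of the polynomial ring $R = k[x_1,\ldots,x_n]$ (standard grading, each variable of degree $1$), where $k$ is a field. For a homogeneous ideal $I$ of $R$, let $\beta_{i,j}$ denote the graded Betti numbers of $R/I$, i.e. the $i$-th module in the graded minimal free resolution of $R/I$ over $R$ is $\bigoplus_j R(-j)^{\beta_{i,j}}$ (with $R$ in homological degree $0$). The (Castelnuovo-Mumford) regularity is $\operatorname{reg}(R/I) = \max\{j-i \mid \beta_{i,j} \neq 0\}$. The Hilbert series of $R/I$ is $H_{R/I}(t) = \sum_{j \geq 0} \dim_k (R/I)_j\, t^j$. It can be written uniquely in lowest terms as $H_{R/I}(t) = h_{R/I}(t)/(1-t)^{\dim(R/I)}$ with $h_{R/I}(t) \in \mathbb{Z}[t]$ and $h_{R/I}(1) \neq 0$, where $\dim(R/I)$ is the Krull dimension; the polynomial $h_{R/I}(t)$ is called the $h$-polynomial of $R/I$. *)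

(* Defs.v *)
From mathcomp Require Import all_boot all_order all_algebra.
From mathcomp Require Import mpoly.

Set Implicit Arguments.
Unset Strict Implicit.
Unset Printing Implicit Defensive.

Import Order.TTheory GRing.Theory Num.Theory.
Local Open Scope ring_scope.

(* Ideals of R = k[x_0, ..., x_(n-1)] are predicates {mpoly k[n]} -> Prop. *)
Definition edge_ideal (k : fieldType) (n : nat) (e : rel 'I_n) :
    {mpoly k[n]} -> Prop :=
  fun p => exists c : 'I_n -> 'I_n -> {mpoly k[n]},
    p = \sum_(i < n) \sum_(j < n | e i j) c i j * ('X_i * 'X_j).

(* A sequence of graded free modules of finite rank
     ... -> F_2 -> F_1 -> F_0,   F_i = \bigoplus_(a < rk i) R(- shift i a).
   Elements of F_i are row vectors, and the map F_(i+1) -> F_i is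
   v |-> v *m diff i.  Shifts may a priori be negative. *)
Record free_sequence (k : fieldType) (n : nat) := FreeSequence {
  rk : nat -> nat;
  shift : forall i : nat, 'I_(rk i) -> int;
  diff : forall i : nat, 'M[{mpoly k[n]}]_(rk i.+1, rk i)
}.

Record is_minimal_resolution (k : fieldType) (n : nat)
    (I : {mpoly k[n]} -> Prop) (F : free_sequence k n) : Prop := {
  (* F_0 = R, generated in degree 0 *)
  minres_rk0 : rk F 0 = 1%N;
  minres_shift0 : forall a : 'I_(rk F 0), shift a = 0;
  (* The maps are homogeneous of degree 0: the (a, b) entry is a form of degree
     shift a - shift b (hence 0 if this is negative). *)
  minres_homog : forall (i : nat) (a : 'I_(rk F i.+1)) (b : 'I_(rk F i))
      (m : 'X_{1..n}),
    m \in msupp (diff F i a b) -> (mdeg m)%:Z + shift b = shift a;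
  (* The cokernel of F_1 -> F_0 = R is R/I; since rk F 0 = 1, const_mx p is the
     row vector with p as its only entry. *)
  minres_coker : forall p : {mpoly k[n]},
    I p <-> exists v : 'rV[{mpoly k[n]}]_(rk F 1), v *m diff F 0 = const_mx p;
  minres_exact : forall (i : nat) (v : 'rV[{mpoly k[n]}]_(rk F i.+1)),
    v *m diff F i = 0 <->
    exists w : 'rV[{mpoly k[n]}]_(rk F i.+2), v = w *m diff F i.+1;
  (* Minimality: F_(i+1) is mapped into (x_0, ..., x_(n-1)) F_i. *)
  minres_min : forall (i : nat) (a : 'I_(rk F i.+1)) (b : 'I_(rk F i)),
    (diff F i a b)@_0%MM = 0
}.

Definition graded_betti (k : fieldType) (n : nat) (F : free_sequence k n)
    (i : nat) (j : int) : nat :=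
  #|[set a : 'I_(rk F i) | shift a == j]|.

Definition is_regularity (k : fieldType) (n : nat)
    (I : {mpoly k[n]} -> Prop) (r : int) : Prop :=
  exists F : free_sequence k n,
    [/\ is_minimal_resolution I F,
        exists (i : nat) (j : int), graded_betti F i j != 0%N /\ r = j - i%:Z
      & forall (i : nat) (j : int), graded_betti F i j != 0%N -> j - i%:Z <= r].

(* H j = dim_k (R/I)_j: there are H j forms of degree j whose classes form a
   basis of R_j / I_j. *)
Definition is_hilbert_function (k : fieldType) (n : nat)
    (I : {mpoly k[n]} -> Prop) (H : nat -> nat) : Prop :=
  forall j : nat, exists B : 'I_(H j) -> {mpoly k[n]},
    (forall s, B s \is j.-homog) /\
    forall p : {mpoly k[n]}, p \is j.-homog ->
      exists! c : 'rV[k]_(H j), I (p - \sum_(s < H j) c 0 s *: B s).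

(* Chains P_0 < ... < P_d of primes of R containing I, i.e. chains of primes of
   R/I.  idealr_closed includes 1 \notin P. *)
Definition prime_chain (k : fieldType) (n : nat)
    (I : {mpoly k[n]} -> Prop) (d : nat)
    (P : 'I_d.+1 -> {pred {mpoly k[n]}}) : Prop :=
  [/\ forall s, idealr_closed (P s) /\ prime_idealr_closed (P s),
      forall s p, I p -> p \in P s
    & forall s t : 'I_d.+1, (s < t)%N ->
        {subset P s <= P t} /\ exists2 p, p \in P t & p \notin P s].

Definition is_krull_dim (k : fieldType) (n : nat)
    (I : {mpoly k[n]} -> Prop) (d : nat) : Prop :=
  (exists P : 'I_d.+1 -> {pred {mpoly k[n]}}, prime_chain I P) /\
  forall (d' : nat) (P : 'I_d'.+1 -> {pred {mpoly k[n]}}),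
    prime_chain I P -> (d' <= d)%N.

(* H_(R/I)(t) = h(t) / (1 - t)^d with d = dim R/I and h(1) <> 0; the equality is
   that of the coefficients of t^j in (1 - t)^d H_(R/I)(t) = h(t). *)
Definition is_h_polynomial (k : fieldType) (n : nat)
    (I : {mpoly k[n]} -> Prop) (h : {poly int}) : Prop :=
  exists (d : nat) (H : nat -> nat),
    [/\ is_krull_dim I d, is_hilbert_function I H,
        forall j : nat,
          \sum_(i < j.+1) ((1 - 'X) ^+ d : {poly int})`_i * (H (j - i)%N)%:Z
          = h`_j
      & h.[1] != 0].

(* Main.v *)
From HB Require Import structures.
Require Import Defs.
From mathcomp Require Import all_boot all_order all_algebra.
From mathcomp Require Import mpoly zify ring.

Set Implicit Arguments.
Unset Strict Implicit.
Unset Printing Implicit Defensive.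

Import Order.TTheory GRing.Theory Num.Theory.
Local Open Scope ring_scope.

(** Let alpha be the largest size of an independent set of the graph G, so that
    n - alpha is the smallest size of a vertex cover.  The theorem is the sum of
    two inequalities, reg (R/I) <= n - alpha and deg h <= alpha.

    The second one is a computation with Hilbert series.  The monomials outside
    I are those whose support is independent, whence
      (1 - t)^alpha H(t)
        = sum over independent A of t^|A| (1 - t)^(alpha - |A|),
    a polynomial of degree at most alpha.  As h is (1 - t)^d H(t) for some d and
    h(1) <> 0, there d <= alpha, and comparing degrees gives deg h <= alpha
    ([size_h_poly]).

    For the first one, let x belong to a vertex cover C of G, in the presence of
    a set W of variables already added to the ideal.  In the exact sequence
      0 -> R/(I : x)(-1) -> R/I -> R/(I + x) -> 0
    both outer ideals are again of the form <edges> + <variables>, and C minus x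
    covers the edges that avoid these variables.  By induction on |C|, the
    regularity of R/I is at most |C| ([mon_reg_le_cover]); for empty C the ideal
    is generated by variables and the regularity is 0 ([mon_reg_le_vars]).

    In this induction regularity is measured by Koszul homology: Tor_i (R/I, k)
    is the homology of the Koszul complex of all the variables with coefficients
    in R/I, and its part of degree j consists of the classes of i-chains whose
    entries are forms of degree j - i.  So reg (R/I) <= c says that a cycle with
    entries of one degree q > c is a boundary, whatever i is; the homological
    grading disappears from the statement ([mon_reg_le]).  Passing to a minimal
    free resolution F is dimension shifting: the bound c for R/I gives the bound
    c + i for the i-th syzygy module, by exactness of the Koszul complex
    over R ([reg_syzygy]).  A generator of F_i of degree greater than c + i would
    then lie in the ideal of the variables times F_i ([shift_le]). *)

(** * Polynomials whose monomials satisfy a predicate *)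

Section Supports.
Variables (k : fieldType) (n : nat).
Implicit Types (P : pred 'X_{1..n}) (p q : {mpoly k[n]}) (x : 'I_n).

(** For P stable under multiplication by variables, this is membership in the
    monomial ideal spanned by P; for P fixing the degree, it is homogeneity.
    Treating both as conditions on supports lets [restr] project onto either. *)
Definition supported P p := forall m, p@_m != 0 -> P m.

Lemma supported_sub P p q :
  supported P p -> supported P q -> supported P (p - q).
Proof.
move=> hp hq m; rewrite mcoeffB => h.
have [p0|/hp //] := eqVneq (p@_m) 0.
by apply: hq; apply: contraNneq h => ->; rewrite p0 subrr.
Qed.

Lemma supported0 P : supported P 0.
Proof. by move=> m; rewrite mcoeff0 eqxx. Qed.

Lemma subXK x (m : 'X_{1..n}) : m x != 0%N -> (m - U_(x) + U_(x))%MM = m.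
Proof. by move=> mx; rewrite submK // lep1mP. Qed.

Lemma mcoeffXM x p m :
  ('X_x * p)@_m = if m x == 0%N then 0 else p@_(m - U_(x))%MM.
Proof.
rewrite mulrC; case: ifPn => [/eqP mx0|mx].
  apply/eqP; rewrite mcoeff_eq0 (perm_mem (msuppMX _ _)).
  apply/negP=> /mapP[m' _ mE].
  by move: mx0; rewrite mE mnmDE mnm1E eqxx.
by rewrite -{1}(subXK mx) addmC mcoeffMX.
Qed.

Lemma mcoeffXM_add x p m : ('X_x * p)@_(m + U_(x)) = p@_m.
Proof. by rewrite mulrC addmC mcoeffMX. Qed.

Definition restr P p := \sum_(m <- msupp p | P m) p@_m *: 'X_[m].

Lemma mcoeff_restr P p m : (restr P p)@_m = if P m then p@_m else 0.
Proof.
rewrite raddf_sum /=; under eq_bigr do rewrite mcoeffZ mcoeffX.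
case: ifPn => Pm; last first.
  rewrite big1 // => m' Pm'; case: eqP => [mE|_]; last by rewrite mulr0.
  by move: Pm; rewrite -mE Pm'.
have [mp|mp] := boolP (m \in msupp p).
  rewrite -big_filter (bigD1_seq m) ?filter_uniq ?mem_filter ?Pm //= eqxx mulr1.
  by rewrite big1 ?addr0 // => m' /negbTE ->; rewrite mulr0.
rewrite (memN_msupp_eq0 mp) big_seq_cond big1 // => m' /andP[m'p _].
by case: eqP => [mE|]; rewrite ?mulr0 //; rewrite -mE m'p in mp.
Qed.

(** The quotient of p by the variable x, leaving out the monomials of p that x
    does not divide. *)
Definition divX x p := \sum_(m <- msupp p | m x != 0%N) p@_m *: 'X_[m - U_(x)].

Lemma mcoeff_divX x p m : (divX x p)@_m = p@_(m + U_(x)).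
Proof.
rewrite -(mcoeffXM_add x).
have -> : 'X_x * divX x p = restr (fun m' => m' x != 0%N) p.
  rewrite mulr_sumr; apply: eq_bigr => m' mx.
  by rewrite -scalerAr -mpolyXD; congr (_ *: 'X_[_]); rewrite addmC subXK.
by rewrite mcoeff_restr mnmDE mnm1E eqxx addn1.
Qed.

(** An element of I + (x), I the span of P, is an element of I plus a multiple of
    x; having both as functions of p allows applying them entrywise. *)
Lemma restr_divX P x p : supported (fun m => P m || (m x != 0%N)) p ->
  p = restr P p + 'X_x * divX x (restr (predC P) p).
Proof.
move=> hp; apply/mpolyP => m; rewrite mcoeffD mcoeff_restr mcoeffXM.
have [m0|mx] := eqVneq (m x) 0%N.
  have [->|/hp] := eqVneq (p@_m) 0; first by rewrite if_same addr0.
  by rewrite m0 eqxx orbF => ->; rewrite addr0.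
rewrite mcoeff_divX mcoeff_restr subXK //=.
by case: (P m); rewrite ?addr0 ?add0r.
Qed.

Lemma restrXM P x p :
  restr P ('X_x * p) = 'X_x * restr (fun m => P (m + U_(x))%MM) p.
Proof.
apply/mpolyP=> m; rewrite mcoeff_restr !mcoeffXM.
have [_|mx] := eqVneq (m x) 0%N; first by rewrite if_same.
by rewrite mcoeff_restr subXK.
Qed.

Lemma restrD P : {morph restr P : p q / p + q}.
Proof.
move=> p q; apply/mpolyP=> m; rewrite mcoeffD !mcoeff_restr mcoeffD.
by case: ifP => _; rewrite ?addr0.
Qed.

Lemma restr_id P p : supported P p -> restr P p = p.
Proof.
move=> hp; apply/mpolyP=> m; rewrite mcoeff_restr; case: ifPn => // hm.
by apply/eqP; rewrite eq_sym; apply: contraNT hm; apply: hp.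
Qed.

Lemma supported_restr P p : supported P (restr P p).
Proof. by move=> m; rewrite mcoeff_restr; case: ifP; rewrite ?eqxx. Qed.

Lemma supportedXM P x p :
  supported P ('X_x * p) <-> supported (fun m => P (m + U_(x))%MM) p.
Proof.
split=> [h m pm|h m]; first by apply: h; rewrite mcoeffXM_add.
by rewrite mcoeffXM; case: ifPn => [|mx /h]; rewrite ?eqxx // subXK.
Qed.

Lemma supportedM P P1 P2 p q :
  (forall m1 m2, P1 m1 -> P2 m2 -> P (m1 + m2)%MM) ->
  supported P1 p -> supported P2 q -> supported P (p * q).
Proof.
move=> h hp hq m; rewrite -mcoeff_msupp.
case/msuppM_le/allpairsP=> -[m1 m2] /= [h1 h2 ->].
by apply: h; [apply: hp|apply: hq]; rewrite -mcoeff_msupp.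
Qed.

Lemma supported_sum (I : Type) (s : seq I) (C : pred I) P
    (F : I -> {mpoly k[n]}) :
  (forall i, C i -> supported P (F i)) -> supported P (\sum_(i <- s | C i) F i).
Proof.
move=> h; apply: (big_ind (supported P)) => // [|p q hp hq].
  exact: supported0.
rewrite -[q]opprK; apply: supported_sub => //; rewrite -sub0r.
by apply: supported_sub => //; apply: supported0.
Qed.

End Supports.

(** * The Koszul complex *)

Section KoszulComplex.
Variables (k : fieldType) (n : nat).
Local Notation R := {mpoly k[n]}.
Implicit Types (M : lmodType R) (xs : seq 'I_n).

(** The total module of the Koszul complex of the variables xs on M: the complex
    of x :: ys is the mapping cone of x on that of ys.  An element is a family of
    2^|xs| entries of M, and no homological grading is kept. *)
Fixpoint koszul M xs : lmodType R :=
  if xs is _ :: ys then (koszul M ys * koszul M ys)%type else M.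

(** For f = (u, v), u is the part of f without the basis vector e_x and v is the
    coefficient of e_x; the sign of the second entry makes the square zero. *)
Fixpoint koszul_diff M xs : koszul M xs -> koszul M xs :=
  if xs is x :: ys return koszul M xs -> koszul M xs then
    fun f => (koszul_diff f.1 + 'X_x *: f.2, - koszul_diff f.2)
  else fun=> 0.

Fixpoint koszul_all M (N : M -> Prop) xs : koszul M xs -> Prop :=
  if xs is x :: ys return koszul M xs -> Prop then
    fun f => koszul_all N f.1 /\ koszul_all N f.2
  else N.

Fixpoint koszul_map M M' (phi : M -> M') xs : koszul M xs -> koszul M' xs :=
  if xs is x :: ys return koszul M xs -> koszul M' xs then
    fun f => (koszul_map phi f.1, koszul_map phi f.2)
  else phi.

(** The entry in homological degree 0. *)
Fixpoint coord0 M xs : koszul M xs -> M :=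
  if xs is x :: ys return koszul M xs -> M then fun f => coord0 f.1 else id.

Fixpoint inj0 M xs (v : M) : koszul M xs :=
  if xs is x :: ys return koszul M xs then (inj0 ys v, 0) else v.

(** Exterior multiplication by e_x. *)
Fixpoint koszul_htpy M (x : 'I_n) xs : koszul M xs -> koszul M xs :=
  if xs is y :: ys return koszul M xs -> koszul M xs then
    fun f =>
      if x == y then (0, f.1) else (koszul_htpy x f.1, - koszul_htpy x f.2)
  else fun=> 0.

Definition subgroup M (N : M -> Prop) :=
  N 0 /\ forall u v, N u -> N v -> N (u - v).

Lemma subgroupD M (N : M -> Prop) u v : subgroup N -> N u -> N v -> N (u + v).
Proof.
move=> [N0 NB] Nu Nv; rewrite -[v]opprK; apply: (NB) => //.
by rewrite -sub0r; apply: NB.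
Qed.

Section Theory.
Variable M : lmodType R.
Implicit Types N : M -> Prop.

Lemma koszul_diff_linear xs a (f g : koszul M xs) :
  koszul_diff (a *: f + g) = a *: koszul_diff f + koszul_diff g.
Proof.
elim: xs f g => [|x xs IH] f g /=; first by rewrite scaler0 addr0.
rewrite !IH; congr (_, _) => /=.
  by rewrite scalerDr scalerDr !scalerA [a * _]mulrC !addrA [X in X + _]addrAC.
by rewrite opprD scalerN.
Qed.
HB.instance Definition _ xs :=
  GRing.isLinear.Build R (koszul M xs) (koszul M xs) _ (@koszul_diff M xs)
    (@koszul_diff_linear xs).

Lemma koszul_diffK xs (f : koszul M xs) : koszul_diff (koszul_diff f) = 0.
Proof.
elim: xs f => [|x xs IH] f //=.
by rewrite linearD linearZ /= scalerN linearN /= !IH add0r subrr !oppr0.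
Qed.

Lemma koszul_htpy_linear x xs a (f g : koszul M xs) :
  koszul_htpy x (a *: f + g) = a *: koszul_htpy x f + koszul_htpy x g.
Proof.
elim: xs f g => [|y xs IH] f g /=; first by rewrite scaler0 addr0.
case: eqP => _; rewrite ?IH; congr (_, _); rewrite /= ?scaler0 ?addr0 //.
by rewrite scalerN opprD.
Qed.
HB.instance Definition _ x xs :=
  GRing.isLinear.Build R (koszul M xs) (koszul M xs) _ (@koszul_htpy M x xs)
    (@koszul_htpy_linear x xs).

(** Multiplication by a variable is null-homotopic on the Koszul complex, so that
    every variable kills Koszul homology. *)
Lemma koszul_htpyP x xs (f : koszul M xs) : x \in xs ->
  'X_x *: f = koszul_diff (koszul_htpy x f) + koszul_htpy x (koszul_diff f).
Proof.
elim: xs f => //= y xs IH f; rewrite inE; case: eqP => [<- _|_ /= xs_x] /=.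
  by congr (_, _) => /=; rewrite ?linear0 ?add0r ?addr0 // addrA addNr add0r.
congr (_, _) => /=.
  rewrite IH // linearD linearZ /= scalerN.
  by rewrite addrACA addNr addr0.
by rewrite IH // !linearN /= !opprK.
Qed.

(** Two maps are allowed because a projection onto forms of degree q of the
    multiples of x comes from the projection onto forms of degree q - 1; for a
    linear map phi and psi coincide. *)
Lemma koszul_map_diff M' (phi psi : M -> M') xs (f : koszul M xs) :
  {morph psi : u v / u + v} -> (forall x v, psi ('X_x *: v) = 'X_x *: phi v) ->
  koszul_map psi (koszul_diff f) = koszul_diff (koszul_map phi f).
Proof.
move=> psiD psiX.
have psi0 : psi 0 = 0 by apply: (addrI (psi 0)); rewrite -psiD !addr0.
have psiN v : psi (- v) = - psi v.
  by apply/eqP; rewrite -addr_eq0 -psiD addNr psi0.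
have kD ys : {morph @koszul_map _ _ psi ys : u v / u + v}.
  by elim: ys => //= y ys IH u v; rewrite !IH.
have kN ys : {morph @koszul_map _ _ psi ys : u / - u}.
  by elim: ys => //= y ys IH u; rewrite !IH.
have kX y ys u : @koszul_map _ _ psi ys ('X_y *: u) = 'X_y *: koszul_map phi u.
  by elim: ys u => //= z ys IH u; rewrite !IH.
by elim: xs f => //= x xs IH f; rewrite kD kN kX !IH.
Qed.

Lemma koszul_all_imply N N' xs (f : koszul M xs) :
  (forall v, N v -> N' v) -> koszul_all N f -> koszul_all N' f.
Proof. by move=> NN'; elim: xs f => //= x xs IH f [/IH ? /IH ?]. Qed.

Lemma koszul_all_subgroup N xs : subgroup N -> subgroup (@koszul_all M N xs).
Proof.
move=> [N0 NB]; elim: xs => //= x xs [K0 KB]; split=> // u v [? ?] [? ?].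
by split; apply: KB.
Qed.

Lemma koszul_all_diff N N' xs (f : koszul M xs) : subgroup N ->
  (forall x v, N' v -> N ('X_x *: v)) ->
  koszul_all N' f -> koszul_all N (koszul_diff f).
Proof.
move=> Ng NX.
have NXs x ys (g : koszul M ys) : koszul_all N' g -> koszul_all N ('X_x *: g).
  by elim: ys g => /= [|y ys IH] g; [exact: NX|case=> /IH ? /IH].
elim: xs f => [|x xs IH] f /=; first by case: Ng.
case=> h1 h2; have KN := koszul_all_subgroup xs Ng.
split; first by apply: subgroupD (KN) _ _; [apply: IH | apply: NXs].
by case: KN => K0 KB; rewrite -[X in koszul_all _ X]sub0r; apply/KB/IH.
Qed.

Lemma koszul_all_scale N a xs (f : koszul M xs) :
  koszul_all N (a *: f) <-> koszul_all (fun v => N (a *: v)) f.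
Proof. by elim: xs f => //= x xs IH f; rewrite !IH. Qed.

Lemma koszul_all_inj0 N xs v : N 0 -> N v -> koszul_all N (inj0 xs v).
Proof.
by move=> N0 Nv; elim: xs => //= x xs IH; split=> //; elim: (xs).
Qed.

Lemma koszul_all_htpy N x xs (f : koszul M xs) : subgroup N ->
  koszul_all N f -> koszul_all N (koszul_htpy x f).
Proof.
move=> Ng; elim: xs f => /= [|y xs IH] f; first by case: Ng.
have [K0 KB] := koszul_all_subgroup xs Ng.
case=> h1 h2; case: eqP => _ /=; split=> //; first exact: IH.
by rewrite -sub0r; apply/KB/IH.
Qed.

Lemma koszul_all_map M' (phi : M -> M') N (N' : M' -> Prop) xs
    (f : koszul M xs) :
  (forall v, N v -> N' (phi v)) ->
  koszul_all N f -> koszul_all N' (koszul_map phi f).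
Proof.
by move=> h; elim: xs f => /= [|x xs IH] f; [exact: h | case=> /IH ? /IH].
Qed.

Lemma koszul_all_image M' (phi : M' -> M) xs (f : koszul M xs) :
  koszul_all (fun v => exists w, v = phi w) f -> exists g, f = koszul_map phi g.
Proof.
elim: xs f => //= x xs IH [f1 f2] [] /= /IH[g1 ->] /IH[g2 ->].
by exists (g1, g2).
Qed.

Lemma koszul_all_map_image M' (phi : M -> M') xs (f : koszul M xs) :
  koszul_all (fun v => exists w, v = phi w) (koszul_map phi f).
Proof. by elim: xs f => /= [|x xs IH] f; [exists f | split]. Qed.

Lemma koszul_map_id_on (phi : M -> M) N xs (f : koszul M xs) :
  (forall v, N v -> phi v = v) -> koszul_all N f -> koszul_map phi f = f.
Proof.
move=> h; elim: xs f => /= [|x xs IH] f; first exact: h.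
by case: f => ? ? [/IH-> /IH->].
Qed.

Lemma koszul_all_eq0 xs (f : koszul M xs) :
  koszul_all (fun v => v = 0) f -> f = 0.
Proof. by elim: xs f => //= x xs IH [f1 f2] [] /= /IH -> /IH ->. Qed.

Lemma koszul_map_eq0 M' (phi : M -> M') xs (f : koszul M xs) :
  koszul_map phi f = 0 -> koszul_all (fun v => phi v = 0) f.
Proof. by elim: xs f => //= x xs IH f [/IH ? /IH ?]. Qed.

Lemma coord0_inj0 xs (v : M) : coord0 (inj0 xs v) = v.
Proof. by elim: xs. Qed.

Lemma koszul_diff_inj0 xs (v : M) : koszul_diff (inj0 xs v) = 0.
Proof.
by elim: xs => //= x xs IH; rewrite IH scaler0 linear0 oppr0 addr0.
Qed.

Lemma coord0_linear xs a (f g : koszul M xs) :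
  coord0 (a *: f + g) = a *: coord0 f + coord0 g.
Proof. by elim: xs f g => //= x xs IH f g; rewrite IH. Qed.
HB.instance Definition _ xs :=
  GRing.isLinear.Build R (koszul M xs) M _ (@coord0 M xs) (@coord0_linear xs).

Lemma koszul_mapB M' (phi : {additive M -> M'}) xs (f g : koszul M xs) :
  koszul_map phi (f - g) = koszul_map phi f - koszul_map phi g.
Proof. by elim: xs f g => /= [|x xs IH] f g; [rewrite raddfB|rewrite !IH]. Qed.

Lemma coord0_map M' (phi : M -> M') xs (f : koszul M xs) :
  coord0 (koszul_map phi f) = phi (coord0 f).
Proof. by elim: xs f => //= x xs IH f; rewrite IH. Qed.

Lemma koszul_map_decomp N (phi psi : M -> M) a xs (f : koszul M xs) :
  (forall v, N v -> v = phi v + a *: psi v) -> koszul_all N f ->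
  f = koszul_map phi f + a *: koszul_map psi f.
Proof.
move=> h; elim: xs f => /= [|x xs IH] f; first exact: h.
by case: f => f1 f2 [] /= /IH {1}-> /IH {1}->.
Qed.

End Theory.
End KoszulComplex.

(** * Regularity of monomial ideals *)

Section Rows.
Variables (k : fieldType) (n : nat).
Local Notation R := {mpoly k[n]}.

Lemma cancel_boundary (V : zmodType) (g a b d : V) :
  g + a + b - (g + d) = a + (b - d).
Proof.
by rewrite opprD addrA -[g + a + b]addrA [g + _]addrC addrK addrA.
Qed.

(** The predicate may depend on the coordinate, to express homogeneity in a free
    module whose generators have different degrees. *)
Definition row_supported r (Q : 'I_r -> pred 'X_{1..n}) (v : 'rV[R]_r) : Prop :=
  forall b, supported (Q b) (v 0 b).

Notation rows_in P := (row_supported (fun=> P)).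

Lemma row_supported_subgroup r (Q : 'I_r -> pred 'X_{1..n}) :
  subgroup (row_supported Q).
Proof.
split=> [b|u v hu hv b]; first by rewrite mxE; apply: supported0.
by rewrite !mxE; apply: supported_sub.
Qed.

Lemma row_supportedX r (Q : 'I_r -> pred 'X_{1..n}) x v :
  row_supported Q ('X_x *: v) <->
  row_supported (fun b m => Q b (m + U_(x))%MM) v.
Proof.
by split=> h b; have := h b; rewrite mxE => /supportedXM.
Qed.

Lemma koszul_rows_subgroup r (Q : 'I_r -> pred 'X_{1..n}) xs :
  subgroup (@koszul_all k n _ (row_supported Q) xs).
Proof. exact/koszul_all_subgroup/row_supported_subgroup. Qed.

Lemma row_supported_imply r (Q Q' : 'I_r -> pred 'X_{1..n}) v :
  (forall b m, Q b m -> Q' b m) -> row_supported Q v -> row_supported Q' v.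
Proof. by move=> h hv b m /hv/h. Qed.

Definition has_mdeg (q : int) : pred 'X_{1..n} := fun m => (mdeg m)%:Z == q.

Lemma has_mdegU q x m : has_mdeg q (m + U_(x))%MM = has_mdeg (q - 1) m.
Proof. by rewrite /has_mdeg mdegD mdeg1; lia. Qed.

Definition upclosed (P : pred 'X_{1..n}) := forall x m, P m -> P (m + U_(x))%MM.

Lemma koszul_diff_supported P r xs (f : koszul 'rV_r xs) : upclosed P ->
  koszul_all (rows_in P) f -> koszul_all (rows_in P) (koszul_diff f).
Proof.
move=> Pup; apply: koszul_all_diff (row_supported_subgroup _) _ => x v h.
by apply/row_supportedX; apply: row_supported_imply h => _; apply: Pup.
Qed.

Lemma koszul_diff_has_mdeg q r xs (f : koszul 'rV_r xs) :
  koszul_all (rows_in (has_mdeg (q - 1))) f ->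
  koszul_all (rows_in (has_mdeg q)) (koszul_diff f).
Proof.
apply: koszul_all_diff (row_supported_subgroup _) _ => x v h.
by apply/row_supportedX; apply: row_supported_imply h => _ m; rewrite has_mdegU.
Qed.

(** reg (R/I) <= c for the monomial ideal I spanned by P, see the introduction: a
    Koszul chain with entries of degree q > c which is a cycle modulo I is a
    boundary modulo I.  Coefficients are taken in (R/I)^r rather than in R/I so
    that the condition applies to F_0 without identifying it with R. *)
Definition mon_reg_le (P : pred 'X_{1..n}) (c : int) :=
  forall r q (f : koszul 'rV_r (enum 'I_n)), c < q ->
    koszul_all (rows_in (has_mdeg q)) f ->
    koszul_all (rows_in P) (koszul_diff f) ->
  exists2 g, koszul_all (rows_in (has_mdeg (q - 1))) g
           & koszul_all (rows_in P) (f - koszul_diff g).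

Lemma mon_reg_le_ext P P' c : P =1 P' -> mon_reg_le P c -> mon_reg_le P' c.
Proof.
move=> eP h r q f cq fh fP.
have [|g gh gP] := h r q f cq fh.
  apply: koszul_all_imply fP => v.
  by apply: row_supported_imply => _ m; rewrite eP.
exists g => //; apply: koszul_all_imply gP => v.
by apply: row_supported_imply => _ m; rewrite eP.
Qed.

Lemma mon_reg_le_weaken P c c' : c <= c' -> mon_reg_le P c -> mon_reg_le P c'.
Proof. by move=> cc' h r q f /(le_lt_trans cc'); apply: h. Qed.

(** The diagram chase shared by the two reduction steps below: modulo boundaries,
    a cycle f of R/I comes from a cycle b of R/(I : x), because f is a boundary
    in R/(I + x).  The entries of b have one degree less than those of f. *)
Lemma mon_reg_le_split P x c r q (f : koszul 'rV_r (enum 'I_n)) : upclosed P ->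
  mon_reg_le (fun m => P m || (m x != 0%N)) c -> c < q ->
  koszul_all (rows_in (has_mdeg q)) f ->
  koszul_all (rows_in P) (koszul_diff f) ->
  exists g a b, [/\ f = koszul_diff g + a + 'X_x *: b,
    koszul_all (rows_in (has_mdeg (q - 1))) g,
    koszul_all (rows_in P) a,
    koszul_all (rows_in (has_mdeg (q - 1))) b
  & koszul_all (rows_in (fun m => P (m + U_(x))%MM)) (koszul_diff b)].
Proof.
move=> Pup hc cq fh fP.
have [|g gh gP] := hc r q f cq fh.
  by apply: koszul_all_imply fP => v; apply: row_supported_imply => _ m ->.
have rh : koszul_all (rows_in (has_mdeg q)) (f - koszul_diff g).
  have [_ hB] := koszul_rows_subgroup (fun _ : 'I_r => has_mdeg q) (enum 'I_n).
  by apply: hB => //; apply: koszul_diff_has_mdeg.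
set w := f - koszul_diff g in gP rh.
set a := koszul_map (map_mx (restr P)) w.
set b := koszul_map (map_mx (fun p => divX x (restr (predC P) p))) w.
have wE : w = a + 'X_x *: b.
  apply: koszul_map_decomp gP => v hv; apply/rowP => i; rewrite !mxE.
  by apply: restr_divX; apply: hv.
have aP : koszul_all (rows_in P) a.
  by apply: koszul_all_map gP => v _ i; rewrite mxE; apply: supported_restr.
have fE : f = koszul_diff g + a + 'X_x *: b by rewrite -addrA -wE addrC subrK.
exists g, a, b; split=> //.
  apply: koszul_all_map rh => v hv i m.
  rewrite mxE mcoeff_divX mcoeff_restr -(has_mdegU _ x).
  by case: ifP => _; [apply: hv | rewrite eqxx].
have xdb : 'X_x *: koszul_diff b = koszul_diff f - koszul_diff a.
  by rewrite fE !linearD linearZ /= koszul_diffK add0r addrC addKr.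
have [_ PB] := koszul_rows_subgroup (fun _ : 'I_r => P) (enum 'I_n).
have := PB _ _ fP (koszul_diff_supported Pup aP).
rewrite -xdb => /koszul_all_scale.
by apply: koszul_all_imply => v /row_supportedX.
Qed.

(** From 0 -> R/(I : x)(-1) -> R/I -> R/(I + x) -> 0, the regularity of R/I is at
    most the larger of reg (R/(I : x)) + 1 and reg (R/(I + x)). *)
Lemma mon_reg_le_colon P x c : upclosed P ->
  mon_reg_le (fun m => P (m + U_(x))%MM) c ->
  mon_reg_le (fun m => P m || (m x != 0%N)) (c + 1) -> mon_reg_le P (c + 1).
Proof.
move=> Pup hcolon hadd r q f cq fh fP.
have [g [a [b [fE gh aP bh dbP]]]] := mon_reg_le_split Pup hadd cq fh fP.
have [g' g'h bP] : exists2 g', koszul_all (rows_in (has_mdeg (q - 1 - 1))) g'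
    & koszul_all (rows_in (fun m => P (m + U_(x))%MM)) (b - koszul_diff g').
  by apply: hcolon dbP => //; lia.
exists (g + 'X_x *: g').
  apply: subgroupD (koszul_rows_subgroup _ _) gh _.
  apply/koszul_all_scale; apply: koszul_all_imply g'h => v h.
  apply/row_supportedX.
  by apply: row_supported_imply h => _ m; rewrite has_mdegU.
have -> : f - koszul_diff (g + 'X_x *: g') = a + 'X_x *: (b - koszul_diff g').
  by rewrite linearD linearZ /= fE scalerBr cancel_boundary.
apply: subgroupD (koszul_rows_subgroup _ _) aP _; apply/koszul_all_scale.
by apply: koszul_all_imply bP => v h; apply/row_supportedX.
Qed.

Definition var_pred (W : {set 'I_n}) : pred 'X_{1..n} :=
  fun m => [exists i in W, m i != 0%N].

Lemma var_pred_upclosed W : upclosed (var_pred W).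
Proof.
move=> x m /existsP[i /andP[iW mi]]; apply/existsP; exists i; rewrite iW mnmDE.
by rewrite addn_eq0 (negbTE mi).
Qed.

Lemma var_predU1 W x m : var_pred (x |: W) m = var_pred W m || (m x != 0%N).
Proof.
apply/existsP/orP => [[i]|[/existsP[i /andP[iW mi]]|mx]].
- rewrite in_setU1 => /andP[/orP[/eqP-> ->|iW mi]]; first by right.
  by left; apply/existsP; exists i; rewrite iW.
- by exists i; rewrite in_setU1 iW orbT.
- by exists x; rewrite in_setU1 eqxx.
Qed.

(** Downward induction on W.  For W full, a form of positive degree lies in the
    ideal.  For x outside W, (W) : x = (W), and the cycle b of R/(W) supplied by
    [mon_reg_le_split] occurs multiplied by x, which kills Koszul homology; so
    the bound does not grow, as it would with [mon_reg_le_colon]. *)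
Lemma mon_reg_le_vars W : mon_reg_le (var_pred W) 0.
Proof.
move: {2}#|~: W| (erefl #|~: W|) => s; elim: s W => [|s IH] W Ws.
  have WT : W = setT.
    apply/setP=> i; have /eqP := Ws; rewrite cards_eq0 => /eqP/setP/(_ i).
    by rewrite !inE => /negbFE.
  move=> r q f q0 fh _; exists 0.
    by have [] := koszul_rows_subgroup (fun _ : 'I_r => has_mdeg (q - 1))
      (enum 'I_n).
  rewrite linear0 subr0.
  apply: koszul_all_imply fh => v; apply: row_supported_imply => _ m.
  rewrite /has_mdeg => /eqP mq; apply/existsP; move: q0.
  rewrite -mq ltz_nat lt0n mdegE.
  by rewrite sum_nat_eq0 => /forall_inPn[i _ mi]; exists i; rewrite WT inE.
have [x xW] : exists x, x \in ~: W by apply/card_gt0P; rewrite Ws.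
move: (xW); rewrite inE => xNW.
have hadd : mon_reg_le (fun m => var_pred W m || (m x != 0%N)) 0.
  apply: (@mon_reg_le_ext (var_pred (x |: W))) => [m|]; first exact: var_predU1.
  apply: IH; apply: succn_inj; rewrite -Ws (cardsD1 x (~: W)) xW add1n.
  by congr (#|pred_of_set _|.+1); apply/setP => i; rewrite !inE negb_or.
have Wup := @var_pred_upclosed W.
move=> r q f q0 fh fP.
have [g [a [b [fE gh aP bh dbP]]]] := mon_reg_le_split Wup hadd q0 fh fP.
exists (g + koszul_htpy x b).
  apply: subgroupD (koszul_rows_subgroup _ _) gh _.
  by apply: koszul_all_htpy bh; apply: row_supported_subgroup.
have -> : f - koszul_diff (g + koszul_htpy x b) =
    a + koszul_htpy x (koszul_diff b).
  rewrite fE (koszul_htpyP _ (mem_enum _ x)) linearD /= cancel_boundary.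
  by rewrite [koszul_diff (koszul_htpy x b) + _]addrC addrK.
apply: subgroupD (koszul_rows_subgroup _ _) aP _.
apply: koszul_all_htpy (row_supported_subgroup _) _.
apply: koszul_all_imply dbP => v.
apply: row_supported_imply => _ m /existsP[i /andP[iW]]; rewrite mnmDE mnm1E.
have [xi|_] := eqVneq x i; first by rewrite xi iW in xNW.
by rewrite addn0 => mi; apply/existsP; exists i; rewrite iW.
Qed.
End Rows.

Notation rows_in P := (row_supported (fun=> P)).

(** * Edge ideals and vertex covers *)

Section EdgePredicates.
Variables (k : fieldType) (n : nat) (e : rel 'I_n).
Hypotheses (e_sym : ssrbool.symmetric e) (e_irr : ssrbool.irreflexive e).

Implicit Types (W C : {set 'I_n}) (m : 'X_{1..n}).

(** The monomials of the ideal generated by the edges and by the variables in W,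
    a class of ideals stable under adding a variable and under colon by one. *)
Definition edge_pred (W : {set 'I_n}) : pred 'X_{1..n} := fun m =>
  var_pred W m || [exists i, exists j, [&& e i j, m i != 0%N & m j != 0%N]].

Lemma edge_predP W m :
  reflect ((exists2 i, i \in W & m i != 0%N) \/
           exists i j, [/\ e i j, m i != 0%N & m j != 0%N])
          (edge_pred W m).
Proof.
apply: (iffP orP) =>
  [[/existsP[i /andP[iW mi]]|]|[[i iW mi]|[i [j [eij mi mj]]]]].
- by left; exists i.
- by case/existsP=> i /existsP[j /and3P[eij mi mj]]; right; exists i, j.
- by left; apply/existsP; exists i; rewrite iW.
- by right; apply/existsP; exists i; apply/existsP; exists j; rewrite eij mi.
Qed.

Lemma mnmDU_neq0 x m i :
  ((m + U_(x))%MM i != 0%N) = (m i != 0%N) || (x == i).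
Proof.
by rewrite mnmDE mnm1E addn_eq0 negb_and; case: (x == i).
Qed.

Lemma edge_pred_upclosed W : upclosed (edge_pred W).
Proof.
move=> x m /edge_predP h; apply/edge_predP.
case: h => [[i iW mi]|[i [j [eij mi mj]]]].
  by left; exists i; rewrite // mnmDU_neq0 mi.
by right; exists i, j; rewrite !mnmDU_neq0 mi mj.
Qed.

(** The edges through x contribute the neighbours of x to I : x. *)
Lemma edge_pred_colon W x m : x \notin W ->
  edge_pred W (m + U_(x))%MM = edge_pred (W :|: [set y | e x y]) m.
Proof.
move=> xW; apply/edge_predP/edge_predP; last first.
  case=> [[i]|[i [j [eij mi mj]]]]; last first.
    by right; exists i, j; rewrite !mnmDU_neq0 mi mj.
  rewrite !inE => /orP[iW|exi] mi.
    by left; exists i; rewrite // mnmDU_neq0 mi.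
  by right; exists x, i; rewrite !mnmDU_neq0 eqxx orbT mi.
case=> [[i iW]|[i [j []]]].
  rewrite mnmDU_neq0 => /orP[mi|/eqP xi]; last by rewrite xi iW in xW.
  by left; exists i; rewrite // inE iW.
rewrite !mnmDU_neq0 => eij /orP[mi|/eqP xi] /orP[mj|/eqP xj].
- by right; exists i, j.
- by left; exists i; rewrite // !inE xj e_sym eij orbT.
- by left; exists j; rewrite // !inE xi eij orbT.
- by move: eij; rewrite -xi -xj e_irr.
Qed.

Lemma edge_predU1 W x m : edge_pred (x |: W) m = edge_pred W m || (m x != 0%N).
Proof. by rewrite /edge_pred var_predU1 orbAC. Qed.

(** Deleting x from C suffices in both outer terms of the exact sequence for x: an
    edge through x contains the variable x of I + (x), and its other end is a
    variable of I : x. *)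
Lemma mon_reg_le_cover W C :
  (forall i j, e i j -> [|| i \in W, j \in W, i \in C | j \in C]) ->
  mon_reg_le k (edge_pred W) #|C|.
Proof.
move: {2}#|C| (erefl #|C|) => s; elim: s W C => [|s IH] W C Cs cov.
  rewrite Cs; apply: (@mon_reg_le_ext _ _ (var_pred W)); last first.
    exact: mon_reg_le_vars.
  move=> m; rewrite /edge_pred; apply/idP/idP=> [->//|/orP[//|]].
  case/existsP=> i /existsP[j /and3P[eij mi mj]].
  have C0 l : l \in C = false.
    by have /eqP := Cs; rewrite cards_eq0 => /eqP->; rewrite inE.
  have := cov i j eij; rewrite !C0 !orbF.
  by case/orP=> lW; apply/existsP; [exists i|exists j]; rewrite lW.
have [x xC] : exists x, x \in C by apply/card_gt0P; rewrite Cs.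
have Ds : #|C :\ x| = s by apply: succn_inj; rewrite -Cs (cardsD1 x C) xC.
have -> : #|C|%:Z = s%:Z + 1 by rewrite Cs; lia.
have [xW|xW] := boolP (x \in W).
  apply: (@mon_reg_le_weaken _ _ _ s%:Z); first by lia.
  rewrite -Ds; apply: IH => // i j /cov; rewrite !inE.
  case: (eqVneq i x) => [->|]; case: (eqVneq j x) => [->|];
    by rewrite ?xW ?orbT.
apply: (@mon_reg_le_colon _ _ _ x); first exact: edge_pred_upclosed.
  apply: (@mon_reg_le_ext _ _ (edge_pred (W :|: [set y | e x y]))).
    by move=> m; rewrite edge_pred_colon.
  rewrite -Ds; apply: IH => // i j eij; move: (cov i j eij); rewrite !inE.
  case: (eqVneq i x) => [<-|_]; first by rewrite eij !orbT.
  case: (eqVneq j x) => [<-|_]; first by rewrite e_sym eij !orbT.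
  by case/or4P=> ->; rewrite ?orbT.
apply: (@mon_reg_le_ext _ _ (edge_pred (x |: W))) => [m|].
  exact: edge_predU1.
apply: (@mon_reg_le_weaken _ _ _ s%:Z); first by lia.
rewrite -Ds; apply: IH => // i j /cov; rewrite !inE.
by case: (eqVneq i x); case: (eqVneq j x); rewrite ?orbT.
Qed.

End EdgePredicates.

(** * Exactness of the Koszul complex over R *)

Section KoszulExactness.
Variables (k : fieldType) (n : nat).
Local Notation R := {mpoly k[n]}.

Definition seq_pred (xs : seq 'I_n) : pred 'X_{1..n} :=
  fun m => has (fun i => m i != 0%N) xs.

Lemma coord0_diff r xs (f : koszul 'rV[R]_r xs) :
  rows_in (seq_pred xs) (coord0 (koszul_diff f)).
Proof.
elim: xs f => [|x xs IH] f /=; first by move=> b m; rewrite mxE mcoeff0 eqxx.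
rewrite linearD linearZ /=; apply: subgroupD (row_supported_subgroup _ _) _ _.
  by apply: row_supported_imply (IH f.1) => _ m /= ->; rewrite orbT.
apply/row_supportedX => b m _ /=.
by rewrite mnmDE mnm1E eqxx addn1.
Qed.

(** The variables form a regular sequence.  As all homological degrees are treated
    at once, the homology R/(xs) in degree 0 has to be excluded, which is the
    hypothesis on coord0 f. *)
Lemma koszul_exact r xs (f : koszul 'rV[R]_r xs) : uniq xs ->
  rows_in (seq_pred xs) (coord0 f) -> koszul_diff f = 0 ->
  exists g, f = koszul_diff g.
Proof.
elim: xs f => [|x xs IH] f /=.
  move=> _ h _; exists 0; apply/rowP => b; rewrite mxE; apply/mpolyP => m.
  by apply/eqP; rewrite mcoeff0; apply: contraT => /h.
case: f => u v /= /andP[xxs uxs] hu [duv /eqP]; rewrite oppr_eq0 => /eqP dv.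
have [N0 NB] := row_supported_subgroup k (fun _ : 'I_r => seq_pred xs).
have [s us] : exists s, rows_in (seq_pred xs) (coord0 u - 'X_x *: s).
  pose dx (p : R) := divX x (restr (predC (seq_pred xs)) p).
  exists (map_mx dx (coord0 u)) => b.
  have hb : supported (fun m => seq_pred xs m || (m x != 0%N)) (coord0 u 0 b).
    by move=> m /hu /=; rewrite orbC.
  by rewrite !mxE {1}(restr_divX hb) addrK; apply: supported_restr.
have [r' vr] : exists r', - v = koszul_diff r'.
  apply: IH => //; last by rewrite linearN /= dv oppr0.
  have -> : - v = 0 - v by rewrite sub0r.
  rewrite linearB linear0 /=; apply: (NB) => //.
  have /row_supportedX : rows_in (seq_pred xs) ('X_x *: coord0 v).
    have -> : 'X_x *: coord0 v = 0 - coord0 (koszul_diff u).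
      apply/eqP; rewrite eq_sym subr_eq -linearZ -linearD /= addrC duv.
      by rewrite linear0.
    by apply: NB => //; apply: coord0_diff.
  apply: row_supported_imply => _ m /hasP[i ixs].
  rewrite mnmDU_neq0 => /orP[mi|/eqP xi].
    by apply/hasP; exists i.
  by rewrite xi ixs in xxs.
(* Changing the degree 0 entry of r' does not change its boundary; with the entry
   s, the degree 0 entry of u - x t falls into the ideal of xs. *)
pose t := r' + inj0 xs (s - coord0 r').
have dt : koszul_diff t = - v by rewrite linearD /= koszul_diff_inj0 addr0 vr.
have [p pE] : exists p, u - 'X_x *: t = koszul_diff p.
  apply: IH => //.
    rewrite linearB linearZ linearD /= coord0_inj0.
    by rewrite [coord0 r' + _]addrC subrK.
  by rewrite linearB linearZ /= dt scalerN opprK.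
by exists (p, t); rewrite /= -pE subrK dt opprK.
Qed.

(** Q q describes the elements of degree q, and the hypothesis on Q says that
    variables have degree 1.  The projection onto degree q - 1 turns any
    primitive of f into a homogeneous one. *)
Lemma koszul_exact_graded r (Q : int -> 'I_r -> pred 'X_{1..n}) q xs
    (f : koszul 'rV[R]_r xs) :
  (forall x b m, Q q b (m + U_(x))%MM = Q (q - 1) b m) ->
  uniq xs -> rows_in (seq_pred xs) (coord0 f) -> koszul_diff f = 0 ->
  koszul_all (row_supported (Q q)) f ->
  exists2 g, koszul_all (row_supported (Q (q - 1))) g & f = koszul_diff g.
Proof.
move=> QU uxs fa df fQ; have [g fE] := koszul_exact uxs fa df.
pose proj z (v : 'rV[R]_r) : 'rV[R]_r := \row_b restr (Q z b) (v 0 b).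
exists (koszul_map (proj (q - 1)) g).
  elim: xs g {f fE df fQ fa uxs} => /= [|x xs IH] v; last by split; apply: IH.
  by move=> b; rewrite mxE; apply: supported_restr.
rewrite -(@koszul_map_diff _ _ _ _ _ (proj q)) -?fE.
- rewrite (koszul_map_id_on _ fQ) // => v hv.
  by apply/rowP => b; rewrite !mxE restr_id.
- by move=> u v; apply/rowP => b; rewrite !mxE restrD.
- move=> x v; apply/rowP => b; rewrite !mxE restrXM; congr ('X_x * _).
  by apply/mpolyP => m; rewrite !mcoeff_restr QU.
Qed.
End KoszulExactness.

(** * Degrees in a minimal free resolution *)

Section MinimalResolution.
Variables (k : fieldType) (n : nat).
Local Notation R := {mpoly k[n]}.

Variables (I : R -> Prop) (P : pred 'X_{1..n}) (c : int).
Variable F : free_sequence k n.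
Hypotheses (F_min : is_minimal_resolution I F)
  (I_supp : forall p, I p <-> supported P p) (I_reg : mon_reg_le k P c).

Let vars := enum 'I_n.
Let delta i := mulmxr (diff F i) : 'rV[R]_(rk F i.+1) -> 'rV[R]_(rk F i).
Definition shifted_mdeg i (q : int) (b : 'I_(rk F i)) : pred 'X_{1..n} :=
  has_mdeg (q - shift b).

Lemma shifted_mdegU i q x (b : 'I_(rk F i)) m :
  shifted_mdeg q b (m + U_(x))%MM = shifted_mdeg (q - 1) b m.
Proof. by rewrite /shifted_mdeg has_mdegU addrAC. Qed.

Lemma koszul_map_delta_diff i xs (f : koszul 'rV[R]_(rk F i.+1) xs) :
  koszul_map (delta (i := i)) (koszul_diff f) =
  koszul_diff (koszul_map (delta (i := i)) f).
Proof.
by apply: koszul_map_diff => [u v|x v]; rewrite /delta /= ?mulmxDl ?scalemxAl.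
Qed.

Lemma delta_shifted_mdeg i q v :
  row_supported (shifted_mdeg q) v ->
  row_supported (shifted_mdeg q) (delta v : 'rV[R]_(rk F i)).
Proof.
move=> hv b; rewrite mxE; apply: supported_sum => a _.
apply: (@supportedM _ _ _ (shifted_mdeg q a)
  (fun m => (mdeg m)%:Z + shift b == shift a)).
- by move=> m1 m2; rewrite /shifted_mdeg /has_mdeg mdegD; lia.
- exact: hv.
- by move=> m; rewrite -mcoeff_msupp => /(minres_homog F_min)/eqP.
Qed.

(** Minimality: the image of each map lies in the ideal of the variables times the
    target, as [koszul_exact] requires. *)
Lemma delta_minimal i v :
  rows_in (seq_pred vars) (delta v : 'rV[R]_(rk F i)).
Proof.
move=> b; rewrite mxE; apply: supported_sum => a _.
apply: (@supportedM _ _ _ predT (fun m => m != 0%MM)) => [m1 m2 _ m20|//|m].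
  apply: contraT => /hasPn m0; case/eqP: m20; apply/mnmP => l.
  have := m0 l (mem_enum _ l); rewrite mnmDE mnm0E negbK addn_eq0.
  by case/andP=> _ /eqP.
by apply: contraNneq => ->; apply/eqP/(minres_min F_min).
Qed.

Lemma im_delta0 v :
  (exists w, v = delta w :> 'rV[R]_(rk F 0)) <-> rows_in P v.
Proof.
have vE b : v = const_mx (v 0 b).
  apply/rowP => b'; rewrite mxE; congr (v 0 _); apply: val_inj.
  by move: b b'; rewrite (minres_rk0 F_min) => b b'; rewrite !ord1.
have b0 : 'I_(rk F 0) by rewrite (minres_rk0 F_min); exact: ord0.
have E : (exists w, v = delta w) <-> I (v 0 b0).
  split=> [[w vw]|].
    by apply/(minres_coker F_min); exists w; rewrite -vE vw.
  by move=> /(minres_coker F_min)[w wv]; exists w; rewrite /delta /= wv -vE.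
rewrite E I_supp; split=> [h b|//]; by rewrite (vE b0) mxE.
Qed.

(** The i-th syzygy module, the cokernel of F_(i+1) -> F_i, has regularity at most
    c + i.  A cycle f with coefficients in the next syzygy module is mapped by
    F_(i+1) -> F_i to a cycle h over R, hence h is the boundary of some f', which
    is a cycle with coefficients in the i-th syzygy module and has degree q - 1;
    a primitive of f' yields one of f. *)
Lemma reg_syzygy i q (f : koszul 'rV[R]_(rk F i) vars) : c + i%:Z < q ->
  koszul_all (row_supported (shifted_mdeg q)) f ->
  koszul_all (fun v => exists w, v = delta w) (koszul_diff f) ->
  exists g g', f = koszul_diff g + koszul_map (delta (i := i)) g'.
Proof.
elim: i q f => [|i IH] q f cq fh fd.
  have [g _ gP] : exists2 g, koszul_all (rows_in (has_mdeg (q - 1))) g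
                          & koszul_all (rows_in P) (f - koszul_diff g).
    apply: I_reg; first by rewrite addr0 in cq; exact: cq.
      apply: koszul_all_imply fh => v; apply: row_supported_imply => b m.
      by rewrite /shifted_mdeg (minres_shift0 F_min) subr0.
    by apply: koszul_all_imply fd => v /im_delta0.
  have gI := koszul_all_imply (fun v => proj2 (im_delta0 v)) gP.
  have [g' E] := koszul_all_image gI.
  by exists g, g'; rewrite -E addrC subrK.
pose h := koszul_map (delta (i := i)) f.
have hd : koszul_diff h = 0.
  rewrite -koszul_map_delta_diff; apply: koszul_all_eq0.
  apply: koszul_all_map fd => v [w ->].
  by apply/(minres_exact F_min); exists w.
have hh : koszul_all (row_supported (shifted_mdeg q)) h.
  by apply: koszul_all_map fh => v; apply: delta_shifted_mdeg.
have ha : rows_in (seq_pred vars) (coord0 h).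
  by rewrite coord0_map; apply: delta_minimal.
have [f' f'h hE] :=
  koszul_exact_graded (@shifted_mdegU i q) (enum_uniq _) ha hd hh.
have [||g [g' f'E]] := IH (q - 1) f' _ f'h; first by lia.
  by rewrite -hE; apply: koszul_all_map_image.
have fK : koszul_map (delta (i := i)) (f - koszul_diff g') = 0.
  rewrite koszul_mapB -/h hE f'E linearD /= koszul_diffK add0r.
  by rewrite koszul_map_delta_diff subrr.
have im : koszul_all (fun v => exists w, v = delta w) (f - koszul_diff g').
  by apply: koszul_all_imply (koszul_map_eq0 fK) => v /(minres_exact F_min).
have [g'' E] := koszul_all_image im.
by exists g', g''; rewrite -E addrC subrK.
Qed.

(** A basis vector in homological degree 0 is a Koszul cycle.  If its degree
    exceeded c + i, [reg_syzygy] would write it as an element of the ideal of the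
    variables times F_i, which contradicts its constant coefficient 1. *)
Lemma shift_le i (a : 'I_(rk F i)) : shift a <= c + i%:Z.
Proof.
rewrite leNgt; apply/negP => ca.
pose f := inj0 vars (delta_mx 0 a : 'rV[R]_(rk F i)).
have [||g [g' fE]] := @reg_syzygy i (shift a) f ca.
- apply: koszul_all_inj0.
    by case: (row_supported_subgroup k (@shifted_mdeg i (shift a))).
  move=> b m; rewrite mxE eqxx /=; have [->|_] := eqVneq b a; last first.
    by rewrite mcoeff0 eqxx.
  rewrite mcoeff1; have [-> _|_] := eqVneq m 0%MM; last by rewrite eqxx.
  by rewrite /shifted_mdeg subrr /has_mdeg mdeg0.
- rewrite koszul_diff_inj0; have im0 : exists w, 0 = delta w :> 'rV[R]_(rk F i).
    by exists 0; rewrite /delta /= mul0mx.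
  by clear f; elim: vars.
have /(_ a 0%MM) : rows_in (seq_pred vars) (delta_mx 0 a : 'rV[R]_(rk F i)).
  rewrite -(coord0_inj0 vars (delta_mx 0 a)) -/f fE linearD /= coord0_map.
  apply: subgroupD (row_supported_subgroup _ _) _ _; first exact: coord0_diff.
  exact: delta_minimal.
rewrite mxE !eqxx mcoeff1 eqxx oner_neq0 => /(_ isT)/hasP[l _].
by rewrite mnm0E.
Qed.

End MinimalResolution.

(** * The edge ideal as a monomial ideal *)

Section EdgeIdeal.
Variables (k : fieldType) (n : nat) (e : rel 'I_n).
Hypothesis e_irr : ssrbool.irreflexive e.

Lemma edge_ideal_supported (p : {mpoly k[n]}) :
  edge_ideal e p <-> supported (edge_pred e set0) p.
Proof.
split=> [[c ->]|hp].
  apply: supported_sum => i _; apply: supported_sum => j eij.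
  apply: (@supportedM _ _ _ predT (edge_pred e set0)) => // [m1 m2 _|m].
    case/edge_predP=> [[l]|[i' [j' [eij' mi mj]]]]; first by rewrite inE.
    apply/edge_predP; right; exists i', j'.
    by rewrite eij' !mnmDE !addn_eq0 (negbTE mi) (negbTE mj) !andbF.
  rewrite -mpolyXD mcoeffX.
  have [<- _|_] := eqVneq (U_(i) + U_(j))%MM m; last by rewrite eqxx.
  apply/edge_predP; right; exists i, j.
  by rewrite eij !mnmDE !mnm1E !eqxx addn1.
rewrite [p]mpolyE.
rewrite big_seq; apply: (big_ind (@edge_ideal k n e)).
- exists (fun _ _ => 0); rewrite big1 // => i _; rewrite big1 // => j _.
  by rewrite mul0r.
- move=> _ _ [c ->] [d ->]; exists (fun i j => c i j + d i j).
  rewrite -big_split; apply: eq_bigr => i _; rewrite -big_split /=.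
  by apply: eq_bigr => j _; rewrite mulrDl.
- move=> m; rewrite mcoeff_msupp => /hp/edge_predP[[l]|[i0 [j0 [eij mi mj]]]].
    by rewrite inE.
  (* Each monomial of p is a multiple of one generator; absence of loops makes
     i0 and j0 distinct, so that the generator is squarefree and divides m. *)
  pose t := p@_m *: 'X_[m - U_(i0) - U_(j0)].
  exists (fun i j => if (i == i0) && (j == j0) then t else 0).
  rewrite (bigD1 i0) //= (bigD1 j0) //= !eqxx /= !big1 ?addr0.
  - rewrite /t -scalerAl -!mpolyXD; congr (_ *: 'X_[_]).
    apply/mnmP => l; rewrite !mnmDE !mnmBE !mnm1E.
    have nij : i0 != j0 by apply: contraTneq eij => ->; rewrite e_irr.
    move: mi mj nij; case: (eqVneq i0 l) => [<-|_];
      case: (eqVneq j0 _) => [->|_]; rewrite ?eqxx //=; lia.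
  - move=> i /negbTE ni; rewrite big1 // => j _; by rewrite ni mul0r.
  - by move=> j /andP[_ /negbTE->]; rewrite mul0r.
Qed.

End EdgeIdeal.

(** * The Hilbert series and the h-polynomial *)

Section HilbertFunction.
Variables (k : fieldType) (n : nat).
Local Notation R := {mpoly k[n]}.
Variables (I : R -> Prop) (P : pred 'X_{1..n}) (H : nat -> nat).
Hypotheses (I_supp : forall p, I p <-> supported P p)
  (I_hilb : is_hilbert_function I H).

(** Monomials with exponents below N, indexed by a finite type; for j < N these
    include all the monomials of degree j. *)
Definition mon_of N (f : {ffun 'I_n -> 'I_N}) : 'X_{1..n} :=
  [multinom (f i : nat) | i < n].

Definition std_mons N j : {set {ffun 'I_n -> 'I_N}} :=
  [set f | (mdeg (mon_of f) == j) && ~~ P (mon_of f)].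

(** A form of degree j lies in I when its coefficients at the standard monomials
    vanish.  So evaluation at these coefficients carries the given basis of
    R_j / I_j to a basis, and the matrix A of this map is invertible. *)
Lemma hilbert_function_std N j : (j < N)%N -> H j = #|std_mons N j|.
Proof.
move=> jN; have [B [Bhom Bbasis]] := I_hilb j.
pose ev (t : 'I_#|std_mons N j|) := mon_of (enum_val t).
have evP t : (mdeg (ev t) = j) /\ ~~ P (ev t).
  by have := enum_valP t; rewrite inE => /andP[/eqP].
pose A := \matrix_(s < H j, t < #|std_mons N j|) (B s)@_(ev t).
have cA (c : 'rV[k]_(H j)) t :
    (\sum_(s < H j) c 0 s *: B s)@_(ev t) = (c *m A) 0 t.
  rewrite raddf_sum mxE; apply: eq_bigr => s _.
  by rewrite mxE; apply: mcoeffZ.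
have coord p (c : 'rV[k]_(H j)) : p \is j.-homog ->
    I (p - \sum_(s < H j) c 0 s *: B s) <-> forall t, p@_(ev t) = (c *m A) 0 t.
  move=> hp; rewrite I_supp; split=> [h t|h m].
    have [_ nP] := evP t; apply/eqP; rewrite -subr_eq0 -cA -mcoeffB.
    by apply: contraNT nP; apply: h.
  apply: contraR => nPm.
  have hd : p - \sum_(s < H j) c 0 s *: B s \is j.-homog.
    by apply: rpredB => //; apply: rpred_sum => s _; apply: rpredZ.
  have [mj|mj] := eqVneq (mdeg m) j; last by rewrite (dhomog_nemf_coeff hd mj).
  have mlt i : (m i < N)%N.
    by apply: leq_ltn_trans jN; rewrite -mj mdegE (bigD1 i) //= leq_addr.
  pose f : {ffun 'I_n -> 'I_N} := [ffun i => Ordinal (mlt i)].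
  have fm : mon_of f = m by apply/mnmP => i; rewrite mnmE ffunE.
  have fS : f \in std_mons N j by rewrite inE fm mj eqxx.
  have := h (enum_rank_in fS f).
  by rewrite -cA /ev enum_rankK_in // fm mcoeffB => ->; rewrite subrr.
have Afree : row_free A.
  apply/inj_row_free => c c0.
  have [c' [_ uniq_c']] := Bbasis 0 (dhomog0 _ _ _).
  rewrite -(uniq_c' c) ?(uniq_c' 0) //; apply/(coord _ _ (dhomog0 _ _ _)) => t.
    by rewrite mul0mx mcoeff0 mxE.
  by rewrite c0 mcoeff0 mxE.
have Afull : row_full A.
  rewrite -sub1mx; apply/row_subP => t; apply/submxP.
  have hX : ('X_[ev t] : R) \is j.-homog.
    by rewrite dhomogX; apply/eqP/(proj1 (evP t)).
  have [c [/(coord _ _ hX) cP _]] := Bbasis _ hX.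
  exists c; apply/rowP => t'; rewrite -cP !mxE mcoeffX.
  congr (nat_of_bool _)%:R.
  apply/eqP/eqP => [->//|/mnmP E]; apply: enum_val_inj; apply/ffunP => i.
  by apply: val_inj; have := E i; rewrite !mnmE.
by rewrite -(eqP Afree) (eqP Afull).
Qed.

End HilbertFunction.

Section HilbertSeries.
Variables (n : nat) (e : rel 'I_n).

Definition independent (A : {set 'I_n}) :=
  [forall i in A, forall j in A, ~~ e i j].

Definition mon_supp (m : 'X_{1..n}) : {set 'I_n} := [set i | m i != 0%N].

Lemma edge_pred_independent m :
  edge_pred e set0 m = ~~ independent (mon_supp m).
Proof.
apply/edge_predP/idP=> [[[i]|[i [j [eij mi mj]]]]|].
- by rewrite inE.
- apply/forall_inPn; exists i; rewrite ?inE //; apply/forall_inPn; exists j.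
    by rewrite inE.
  by rewrite eij.
- case/forall_inPn=> i; rewrite inE => mi /forall_inPn[j]; rewrite inE => mj.
  by rewrite negbK => eij; right; exists i, j.
Qed.

(** An approximation of the Hilbert series: below degree N the coefficients count
    the standard monomials.  Working with polynomials modulo t^N avoids formal
    power series. *)
Definition std_poly N : {poly int} :=
  \sum_(f : {ffun 'I_n -> 'I_N} | ~~ edge_pred e set0 (mon_of f))
    'X^(mdeg (mon_of f)).

Lemma coef_std_poly N j :
  (std_poly N)`_j = #|std_mons (edge_pred e set0) N j|%:Z.
Proof.
rewrite coef_sum; under eq_bigr do rewrite coefXn.
rewrite -sum1_card -natz natr_sum big_mkcond [RHS]big_mkcond /=.
apply: eq_bigr => f _.
by rewrite inE eq_sym; case: eqP; case: edge_pred.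
Qed.

(** Group the standard monomials by support: over the support A, each exponent
    ranges freely over the positive values. *)
Lemma std_poly_independent N : std_poly N.+1 =
  \sum_(A | independent A) (\sum_(a < N.+1 | a != ord0) 'X^a) ^+ #|A|.
Proof.
pose S (f : {ffun 'I_n -> 'I_N.+1}) := mon_supp (mon_of f).
rewrite /std_poly (partition_big S independent) /=; last first.
  by move=> f; rewrite edge_pred_independent negbK.
apply: eq_bigr => A Aind.
pose Q (i : 'I_n) (a : 'I_N.+1) := (a != ord0) == (i \in A).
have -> : (\sum_(a < N.+1 | a != ord0) 'X^a) ^+ #|A| =
    \prod_i \sum_(a | Q i a) 'X^a :> {poly int}.
  rewrite -prodr_const big_mkcond /=; apply: eq_bigr => i _.
  case: ifPn => iA; first by apply: eq_bigl => a; rewrite /Q iA eqb_id.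
  rewrite (bigD1 ord0) ?/Q ?eqxx ?(negbTE iA) //= big1 ?addr0 // => a.
  by case: (a == ord0).
rewrite bigA_distr_big_dep; apply: eq_big => [f|f _].
  apply/andP/familyP => [[_ /eqP fA] i|fQ].
    by rewrite unfold_in /Q -fA inE mnmE.
  have fA : S f = A.
    by apply/setP => i; have := fQ i; rewrite unfold_in inE mnmE => /eqP.
  by rewrite edge_pred_independent -/(S f) fA Aind.
rewrite mdegE -prodrXr; apply: eq_bigr => i _; by rewrite mnmE.
Qed.

Lemma geometric_poly N :
  (1 - 'X) * (\sum_(a < N.+1 | a != ord0) 'X^a) = 'X - 'X^(N.+1) :> {poly int}.
Proof.
rewrite big_mkcond big_ord_recl /= add0r.
under eq_bigr do rewrite exprS.
rewrite -mulr_sumr mulrCA -(opprB 'X 1) mulNr -subrX1 opprB.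
by rewrite mulrBr mulr1 -exprS.
Qed.

(** The expected value of (1 - t)^al H(t), with al at least the size of every
    independent set. *)
Definition h_numerator (al : nat) : {poly int} :=
  \sum_(A | independent A) (1 - 'X) ^+ (al - #|A|) * 'X^#|A|.

Lemma hilbert_numerator al N : (forall A, independent A -> (#|A| <= al)%N) ->
  exists r, (1 - 'X) ^+ al * std_poly N.+1 = h_numerator al + 'X^(N.+1) * r.
Proof.
move=> al_max; rewrite std_poly_independent mulr_sumr.
rewrite /h_numerator.
apply: (big_ind2 (fun p q => exists r, p = q + 'X^(N.+1) * r)).
- by exists 0; rewrite mulr0 addr0.
- move=> p1 q1 p2 q2 [r1 ->] [r2 ->]; exists (r1 + r2); ring.
- move=> A /al_max Aal.
  have [r rE] : exists r,
      ('X - 'X^(N.+1)) ^+ #|A| = 'X^#|A| + 'X^(N.+1) * r :> {poly int}.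
    elim: #|A| => [|s [r rE]]; first by exists 0; rewrite !expr0 mulr0 addr0.
    exists (r * 'X - ('X^s + 'X^(N.+1) * r)).
    rewrite exprSr rE ['X^(s.+1)]exprSr; ring.
  exists ((1 - 'X) ^+ (al - #|A|) * r).
  rewrite -{1}(subnK Aal) exprD -mulrA -exprMn geometric_poly rE; ring.
Qed.

Lemma size_1subX_exp d : size ((1 - 'X : {poly int}) ^+ d) = d.+1.
Proof. by rewrite -opprB exprNn size_Msign size_exp_XsubC. Qed.

Lemma size_h_numerator al : (forall A, independent A -> (#|A| <= al)%N) ->
  (size (h_numerator al) <= al.+1)%N.
Proof.
move=> al_max; apply: (leq_trans (size_sum _ _ _)).
apply/bigmax_leqP => A /al_max Aal.
apply: (leq_trans (size_polyMleq _ _)); rewrite size_1subX_exp size_polyXn; lia.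
Qed.

Lemma eq_poly_modXn (p q : {poly int}) N :
  (forall i, (i < N)%N -> p`_i = q`_i) ->
  exists r, p = q + 'X^N * r.
Proof.
move=> pq; exists (drop_poly N (p - q)).
rewrite mulrC -[LHS](subrK q) addrC; congr (_ + _).
rewrite -{1}(poly_take_drop N (p - q)) -[RHS]add0r; congr (_ + _).
apply/polyP => i; rewrite coef_take_poly coef0 coefB.
by case: ifP => // /pq ->; rewrite subrr.
Qed.

(** Both h / (1 - t)^d and h_numerator al / (1 - t)^al are the Hilbert series, so
    they agree.  If al < d, then h would be divisible by 1 - t, against h(1) <> 0;
    if d <= al, then
    deg h = deg (h_numerator al) - (al - d) <= d. *)
Lemma size_h_poly (h : {poly int}) d al :
  (forall A, independent A -> (#|A| <= al)%N) ->
  (forall N j, (j < N)%N -> ((1 - 'X) ^+ d * std_poly N)`_j = h`_j) ->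
  h.[1] != 0 -> (size h <= al.+1)%N.
Proof.
move=> al_max hE h1.
have gE : (1 - 'X) ^+ al * h = (1 - 'X) ^+ d * h_numerator al.
  apply/polyP => j; apply/eqP; rewrite -subr_eq0 -coefB.
  have [r rE] := hilbert_numerator j al_max.
  have [s sE] := eq_poly_modXn (fun i => esym \o @hE j.+1 i).
  have -> : (1 - 'X) ^+ al * h - (1 - 'X) ^+ d * h_numerator al =
     'X^(j.+1) * ((1 - 'X) ^+ d * r + (1 - 'X) ^+ al * s).
    rewrite sE mulrDr mulrCA rE; ring.
  by rewrite coefXnM ltnSn.
have X0 s : (1 - 'X : {poly int}) ^+ s != 0.
  by rewrite -size_poly_gt0 size_1subX_exp.
have [dal|ald] := leqP d al.
  have h0 : h != 0 by apply: contraNneq h1 => ->; rewrite horner0.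
  have g0 : h_numerator al != 0.
    apply: contraNneq h0 => g0; move/eqP: gE.
    by rewrite g0 mulr0 mulf_eq0 (negbTE (X0 _)).
  have := congr1 (fun p : {poly int} => size p) gE.
  rewrite !size_mul // !size_1subX_exp !addSn /= => szE.
  rewrite -(leq_add2l al).
  apply: leq_trans (leq_add dal (size_h_numerator al_max)).
  by rewrite -szE.
have hg : h = (1 - 'X) ^+ (d - al) * h_numerator al.
  by apply: (mulfI (X0 al)); rewrite gE mulrA -exprD subnKC // ltnW.
move: h1; rewrite hg hornerM horner_exp !hornerE subrr expr0n.
by rewrite subn_eq0 leqNgt ald /= mul0r eqxx.
Qed.

End HilbertSeries.

Theorem theorem1p2 (k : fieldType) (n : nat) (e : rel 'I_n)
    (e_sym : ssrbool.symmetric e) (e_irr : ssrbool.irreflexive e)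
    (r : int) (h : {poly int})
    (reg_r : is_regularity (@edge_ideal k n e) r)
    (h_poly : is_h_polynomial (@edge_ideal k n e) h) :
  r + (size h).-1%:Z <= n%:Z.
Proof.
have ind0 : independent e set0 by apply/forall_inP => i; rewrite inE.
pose A := [arg max_(A > set0 | independent e A) #|A|].
have [indA maxA] :
    independent e A /\ forall B, independent e B -> (#|B| <= #|A|)%N.
  by rewrite /A; case: arg_maxnP.
have size_h : (size h <= #|A|.+1)%N.
  have [d [H [_ hilb hE h1]]] := h_poly.
  apply: (@size_h_poly _ e h d) => // N j jN; rewrite -hE coefM.
  apply: eq_bigr => i _; congr (_ * _).
  have I_supp := @edge_ideal_supported k n e e_irr.
  rewrite coef_std_poly (hilbert_function_std I_supp hilb (N := N)) //.
  by rewrite (leq_ltn_trans _ jN) ?leq_subr.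
(* The complement of the independent set A is a vertex cover. *)
have reg_le_C : r <= #|~: A|%:Z.
  have [F [Fmin [i [j [b0 ->]]] _]] := reg_r.
  have [a] : exists a, a \in [set a : 'I_(rk F i) | shift a == j].
    by apply/card_gt0P; rewrite lt0n.
  rewrite inE => /eqP <-; rewrite lerBlDr.
  apply: (shift_le Fmin (@edge_ideal_supported k n e e_irr)) => //.
  apply: mon_reg_le_cover => // i' j' eij; rewrite !inE /=.
  rewrite -negb_and; apply: contraL eij => /andP[i'A j'A].
  by move/forall_inP: indA => /(_ i' i'A)/forall_inP/(_ j' j'A).
have := cardsC A; rewrite card_ord; move: size_h reg_le_C.
by case: (size h) => [|s] /=; lia.
Qed.
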